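(* Let $X$ be a real random variable with cumulative distribution function $F$, and let $\varepsilon$ be a centered Gaussian random variable with variance $\sigma^2>0$, independent of $X$. Let $Y=X+\varepsilon$, let $Y_1,Y_2,\ldots$ be a sequence of independent copies of $Y$, and define $M_n=\max\{Y_1,\ldots,Y_n\}$ for all $n\ge 1$. Let $b_n=\sqrt{2\sigma^2\ln n}$. Assume that there exist real numbers $\theta_F\in\mathbb{R}$, $\alpha\ge\beta\ge 0$, $r>0$ and $L>0$ such that $\theta_F$ is the right endpoint of the distribution of $X$ (so $F(\theta_F)=1$) and $$L^{-1}t^{\alpha}\le 1-F(\theta_F-t)\le Lt^{\beta},\qquad \forall t\in[0,r].$$ Then there exist $n_0\ge 1$ and $c_0,c_1,c_2>0$ that depend on $\alpha,\beta,L,r$ and $\sigma^2$ only, such that for all $n\ge n_0$ and all $t>0$, $$\mathbb{P}\left[|M_n-b_n-\theta_F|>\frac{t+c_0\ln\ln n}{b_n}\right]\le c_1e^{-\frac{t}{2\sigma^2}}+e^{-c_2n}.$$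
   Context: $\ln$ denotes the natural logarithm. *)

(* Defs.v *)
From HB Require Import structures.
From mathcomp Require Import all_boot all_order all_algebra.
From mathcomp Require Import all_classical all_reals all_analysis.
Set Implicit Arguments.
Unset Strict Implicit.
Unset Printing Implicit Defensive.
Import Order.TTheory GRing.Theory Num.Theory.
Local Open Scope classical_set_scope.
Local Open Scope ring_scope.

(* Laws are compared on measurable sets only: the value of a measure on a
   non-measurable set is meaningless. *)
Definition has_law (d : measure_display) (T : measurableType d) (R : realType)
    (P : probability T R) (X : {RV P >-> R}) (mu : set R -> \bar R) : Prop :=
  forall A : set R, measurable A -> distribution P X A = mu A.

Definition independent_RV2 (d : measure_display) (T : measurableType d)
    (R : realType) (P : probability T R) (X Y : {RV P >-> R}) : Prop :=
  forall A B : set R, measurable A -> measurable B ->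
    (P (X @^-1` A `&` Y @^-1` B) = P (X @^-1` A) * P (Y @^-1` B))%E.

Definition mutually_independent (d : measure_display) (T : measurableType d)
    (R : realType) (P : probability T R) (Y : nat -> {RV P >-> R}) : Prop :=
  forall (s : seq nat) (A : nat -> set R), uniq s ->
    (forall i, measurable (A i)) ->
    (P (\bigcap_(i in [set` s]) (Y i @^-1` A i)) =
     \prod_(i <- s) P (Y i @^-1` A i))%E.

Definition right_endpoint (d : measure_display) (T : measurableType d)
    (R : realType) (P : probability T R) (X : {RV P >-> R}) : \bar R :=
  ereal_sup [set x%:E | x in [set x : R | (cdf X x < 1)%E]].

(* With F the cdf of X, L^-1 t^alpha <= 1 - F (theta - t) <= L t^beta near
   t = 0. The point t = 0 is left out: there, as 1 - F theta = 0 at the right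
   endpoint, the bounds hold trivially if 0 < alpha, whereas for alpha = 0 (an
   atom at theta) the convention 0 `^ 0 = 1 would make the lower one absurd. *)
Definition endpoint_tail_bounds (d : measure_display) (T : measurableType d)
    (R : realType) (P : probability T R) (X : {RV P >-> R})
    (theta alpha beta r L : R) : Prop :=
  forall t : R, 0 < t <= r ->
    ((L^-1 * t `^ alpha)%:E <= 1 - cdf X (theta - t)%R <= (L * t `^ beta)%:E)%E.

(* max {Y_1, ..., Y_n} for n >= 1, with Y i standing for Y_(i+1). *)
Definition running_max (T : Type) (R : realType) (Y : nat -> T -> R) (n : nat)
    (w : T) : R :=
  \big[Num.max/Y 0%N w]_(i < n) Y i w.

Definition gauss_max_level (R : realType) (sigma : R) (n : nat) : R :=
  Num.sqrt (2 * sigma ^+ 2 * ln n%:R).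

(* Main.v *)
Require Import Defs.
From HB Require Import structures.
From mathcomp Require Import all_boot all_order all_algebra.
From mathcomp Require Import all_classical all_reals all_analysis.
From mathcomp Require Import ring lra measurable_realfun.
Set Implicit Arguments.
Unset Strict Implicit.
Unset Printing Implicit Defensive.
Import Order.TTheory GRing.Theory Num.Theory.
Local Open Scope classical_set_scope.
Local Open Scope ring_scope.

(** Why the maximum concentrates. Put [b] for the level [gauss_max_level sigma n],
    so that [n * expR (- b ^+ 2 / (2 * sigma ^+ 2)) = 1], and write the threshold
    as [s / b] with [s = t + c0 * ln (ln n)]. Squaring [b + s / b] or [b - s / b]
    moves the Gaussian exponent by about [s / sigma ^+ 2] on either side of this
    balance.

    Too large a maximum. As [X] does not exceed its right endpoint [theta], the
    event [Y > theta + v] forces [eps > v] up to an arbitrarily small slack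
    ([gauss_sum_tail_le]). A union bound over the [n] copies and the Gaussian tail
    [expR (- v ^+ 2 / (2 * sigma ^+ 2))] at [v = b + s / (2 * b)] then give
    [expR (- s / (2 * sigma ^+ 2))] ([union_bound_at_level]).

    Too small a maximum. By independence its probability is at most
    [expR (- n * P (Y >= theta + u))] with [u = b - s / b]. One way for [Y] to be
    that large is that [X > theta - delta] and [eps >= u + delta]; this has
    probability at least [L^-1 * delta `^ alpha] times a Gaussian tail
    ([gauss_sum_tail_ge]). With [delta = r / b] a power [b `^ (- (alpha + 1))] is
    lost, and [c0 = sigma ^+ 2 * (alpha + 1)] is the value for which the term
    [c0 * ln (ln n)] of [s] pays for it exactly. Hence [n * P (Y >= theta + u)] is
    at least a constant times [expR (t / (2 * sigma ^+ 2))]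
    ([expected_exceedances_ge]), and a double exponential decay is more than what
    is claimed.

    The second order term [(s / b) ^+ 2] is at most [s] only while
    [s <= b ^+ 2], which is where the factor [2] in the exponent of the theorem
    comes from. Beyond that range [u < 0], each copy exceeds [theta] with a fixed
    positive probability, and the bound is exponentially small in [n]. *)

(** * Tails of the normal law *)

(** For [x >= v >= 0] one has [x ^+ 2 >= v ^+ 2 + (x - v) ^+ 2], so the centered
    density is dominated by [expR (- v ^+ 2 / (2 * s ^+ 2))] times the density of
    the normal law centered at [v], whose total mass is 1. *)
Lemma normal_prob_tail_le (R : realType) (s v : R) (A : set R) :
  s != 0 -> 0 <= v -> measurable A -> (forall x, A x -> v <= x) ->
  (normal_prob 0 s A <= (expR (- v ^+ 2 / (2 * s ^+ 2)))%:E)%E.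
Proof.
move=> s0 v0 mA Av.
set c := expR _.
have s2 : 0 < s ^+ 2 by rewrite exprn_even_gt0.
apply: (@le_trans _ _ (c%:E * normal_prob v s A)%E); last first.
  rewrite -[leRHS]mule1 lee_pmul2l ?fin_numE// ?lte_fin ?expR_gt0//.
  exact: (@probability_le1 _ _ _ (normal_prob v s)).
rewrite /normal_prob -ge0_integralZl//=.
- apply: ge0_le_integral => //=.
  + by move=> x _; rewrite lee_fin normal_pdf_ge0.
  + apply/measurable_EFinP; apply: measurable_funTS.
    exact: measurable_normal_pdf.
  + apply/measurable_EFinP; apply: measurable_funTS.
    by apply: measurable_funM => //; exact: measurable_normal_pdf.
  + move=> x /Av vx; rewrite -EFinM lee_fin !normal_pdfE// /normal_fun subr0.
    rewrite mulrCA ler_pM2l ?normal_peak_gt0// /c -expRD ler_expR.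
    rewrite [_ *+ 2](_ : _ = 2 * s ^+ 2); last by rewrite mulr_natl.
    rewrite -mulrDl ler_pM2r ?invr_gt0; last by rewrite mulr_gt0.
    by nra.
- apply/measurable_EFinP; apply: measurable_funTS.
  exact: measurable_normal_pdf.
- by move=> x _; rewrite lee_fin normal_pdf_ge0.
- by rewrite lee_fin expR_ge0.
Qed.

(** The density decreases on [[v, v + h]], hence is at least its value at the
    right end of this interval. This loses only a constant compared to the exact
    tail when [h] is of the order of [v^-1]. *)
Lemma normal_prob_tail_ge (R : realType) (s v h : R) :
  s != 0 -> 0 <= v -> 0 <= h ->
  ((h * normal_pdf 0 s (v + h))%:E <= normal_prob 0 s `[v, +oo[)%E.
Proof.
move=> s0 v0 h0.
have s2 : 0 < s ^+ 2 by rewrite exprn_even_gt0.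
have mpdf (A : set R) : measurable_fun A (EFin \o normal_pdf 0 s).
  by apply/measurable_EFinP/measurable_funTS; exact: measurable_normal_pdf.
apply: (@le_trans _ _ (normal_prob 0 s `[v, v + h])); last first.
  apply: ge0_subset_integral => //=.
    exact: mpdf.
    by move=> x _; rewrite lee_fin normal_pdf_ge0.
  by apply: subset_itv; rewrite ?bnd_simp.
have -> : (h * normal_pdf 0 s (v + h))%:E =
    (\int[lebesgue_measure]_(x in `[v, (v + h)%R]) (normal_pdf 0 s (v + h))%:E)%E.
  rewrite integral_cst//= lebesgue_measure_itv/= lte_fin.
  case: ifPn => [_|]; first by rewrite -EFinB -EFinM addrAC subrr add0r mulrC.
  rewrite -leNgt gerDl => hle0; have -> : h = 0 by apply/eqP; rewrite eq_le hle0.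
  by rewrite mul0r mule0.
apply: ge0_le_integral => //=.
- by move=> x _; rewrite lee_fin normal_pdf_ge0.
- exact: mpdf.
- move=> x; rewrite in_itv/= => /andP[vx xvh].
  rewrite lee_fin !normal_pdfE// /normal_fun !subr0.
  rewrite ler_pM2l ?normal_peak_gt0// ler_expR !mulNr lerN2.
  rewrite ler_pM2r ?invr_gt0 ?mulrn_wgt0//; nra.
Qed.

(** * Tail of a sum with an independent noise *)

Section convolution.
Context (d : measure_display) (T : measurableType d) (R : realType).
Context (P : probability T R).
Local Open Scope ereal_scope.

Lemma measurable_RV_preimage (Z : {RV P >-> R}) (B : set R) :
  measurable B -> measurable (Z @^-1` B).
Proof.
by move=> mB; rewrite -[X in measurable X]setTI; apply: measurable_funPT.
Qed.

Lemma prob_sub (A B : set T) : measurable A -> measurable B -> A `<=` B ->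
  P A <= P B.
Proof. by move=> mA mB AB; apply: le_measure; rewrite ?inE. Qed.

Lemma prob_gt_right_endpoint (X : {RV P >-> R}) (theta a : R) :
  right_endpoint X = theta%:E -> (theta < a)%R -> P (X @^-1` `]a, +oo[) = 0.
Proof.
move=> Xtheta thetaa.
have cdf1 : cdf X a = 1.
  apply/eqP; rewrite eq_le cdf_le1 leNgt; apply/negP => a1.
  have : a%:E <= right_endpoint X by apply: ereal_sup_ubound; exists a.
  by rewrite Xtheta lee_fin leNgt thetaa.
rewrite -[LHS]/(ccdf X a) ccdf_1_cdf cdf1 subee//.
Qed.

Lemma sum_tail_ge (X eps Y : {RV P >-> R}) (a v : R) :
  independent_RV2 X eps -> (forall w, Y w = X w + eps w)%R ->
  P (X @^-1` `]a, +oo[) * P (eps @^-1` `[v, +oo[) <=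
  P (Y @^-1` `[(a + v)%R, +oo[).
Proof.
move=> ind YE; rewrite -ind//; apply: prob_sub.
- by apply: measurableI; exact: measurable_RV_preimage.
- exact: measurable_RV_preimage.
- move=> w /= []; rewrite !in_itv/= !andbT YE => ? ?; exact: lerD (ltW _) _.
Qed.

Lemma sum_tail_le (X eps Y : {RV P >-> R}) (a v : R) :
  (forall w, Y w = X w + eps w)%R -> P (X @^-1` `]a, +oo[) = 0 ->
  P (Y @^-1` `](a + v)%R, +oo[) <= P (eps @^-1` `]v, +oo[).
Proof.
move=> YE Xa.
have mpre := measurable_RV_preimage.
rewrite -[leRHS]adde0 -Xa; apply: le_trans (measureU2 _ (mpre _ _ _) (mpre _ _ _)) => //.
apply: prob_sub; [exact: mpre|by apply: measurableU; exact: mpre|].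
move=> w /=; rewrite !in_itv/= !andbT YE => aw.
by case: (ltP v (eps w)) => ?; [left|right; lra].
Qed.

End convolution.

(** * Law of the running maximum *)

Section running_max_law.
Context (d : measure_display) (T : measurableType d) (R : realType).
Context (P : probability T R) (Ys : nat -> {RV P >-> R}) (Y : {RV P >-> R}).
Hypothesis YsY : forall i, has_law (Ys i) (distribution P Y).
Local Open Scope ereal_scope.

Lemma running_max_gtE n a : (0 < n)%N ->
  [set w | a < running_max Ys n w]%R =
  \big[setU/set0]_(i < n) (Ys i @^-1` `]a, +oo[).
Proof.
move=> n0; rewrite -(bigcup_mkord n (fun i => Ys i @^-1` `]a, +oo[)).
apply/seteqP; split=> w /=.
  rewrite /running_max => /bigmax_gtP[aw|[i _ aw]].
    by exists 0%N => //=; rewrite in_itv/= andbT.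
  by exists i => //=; rewrite in_itv/= andbT.
move=> [i /= iltn]; rewrite in_itv/= andbT => aw; apply/bigmax_gtP; right.
by exists (Ordinal iltn).
Qed.

Lemma running_max_ltE n a : (0 < n)%N ->
  [set w | running_max Ys n w < a]%R =
  \bigcap_(i in [set` iota 0 n]) (Ys i @^-1` `]-oo, a[).
Proof.
move=> n0; apply/seteqP; split=> w /=.
  move=> /bigmax_ltP[_ aw] i /=; rewrite mem_iota add0n => iltn.
  by rewrite in_itv/=; exact: (aw (Ordinal iltn)).
move=> aw.
have {}aw i : (i < n)%N -> (Ys i w < a)%R.
  by move=> iltn; have := aw i; rewrite /= in_itv/= mem_iota; apply.
by apply/bigmax_ltP; split=> [|i _]; exact: aw.
Qed.

Lemma measurable_running_max_gt n a : (0 < n)%N ->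
  measurable [set w | a < running_max Ys n w]%R.
Proof.
move=> n0; rewrite running_max_gtE//; apply: bigsetU_measurable => i _.
exact: measurable_RV_preimage.
Qed.

Lemma measurable_running_max_lt n a : (0 < n)%N ->
  measurable [set w | running_max Ys n w < a]%R.
Proof.
move=> n0; rewrite running_max_ltE//; apply: bigcap_measurable => [|i _].
  by exists 0%N; rewrite /= mem_iota.
exact: measurable_RV_preimage.
Qed.

Lemma prob_running_max_gt_le n a : (0 < n)%N ->
  P [set w | a < running_max Ys n w]%R <= n%:R%:E * P (Y @^-1` `]a, +oo[).
Proof.
move=> n0; rewrite running_max_gtE//.
apply: (le_trans (Boole_inequality P (A := fun i => Ys i @^-1` `]a, +oo[) _)).
  move=> i _.
  exact: measurable_RV_preimage.
rewrite (eq_bigr (fun=> P (Y @^-1` `]a, +oo[))) => [|i _].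
  by rewrite mule_natl sumr_const card_ord.
exact: (YsY i (measurable_itv `]a, +oo[)).
Qed.

Hypothesis indY : mutually_independent Ys.

(** The probability is [(1 - P (Y >= a)) ^+ n], and [1 - q <= expR (- q)]. *)
Lemma prob_running_max_lt_le n a q : (0 < n)%N ->
  q%:E <= P (Y @^-1` `[a, +oo[) ->
  P [set w | running_max Ys n w < a]%R <= (expR (- (n%:R * q)))%:E.
Proof.
move=> n0 qle; rewrite running_max_ltE//.
rewrite (indY (A := fun=> `]-oo, a[%classic)) ?iota_uniq//.
have mY : measurable (Y @^-1` `[a, +oo[).
  exact: measurable_RV_preimage.
rewrite (eq_bigr (fun=> 1 - P (Y @^-1` `[a, +oo[))) => [|i _]; last first.
  rewrite [LHS](YsY i (measurable_itv `]-oo, a[)).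
  by rewrite -probability_setC// preimage_setC setCitvr.
have /fineK <- := fin_num_measure P _ mY.
have {}qle : (q <= fine (P (Y @^-1` `[a, +oo[)))%R.
  by rewrite -lee_fin fineK// fin_num_measure.
have p1 : (fine (P (Y @^-1` `[a, +oo[)) <= 1)%R.
  by rewrite -lee_fin fineK ?fin_num_measure// probability_le1.
rewrite -EFinB prodEFin lee_fin big_const_seq count_predT size_iota iter_mulr_1.
rewrite -mulrN expRM_natl lerXn2r ?nnegrE ?expR_ge0 ?subr_ge0//.
apply: le_trans (expR_ge1Dx _); lra.
Qed.

End running_max_law.

(** * Calculus at the level of the Gaussian maximum *)

Section numeric.
Context (R : realType) (sigma : R).
Hypothesis sigma0 : 0 < sigma.

Let var2_gt0 : 0 < 2 * sigma ^+ 2.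
Proof. by rewrite mulr_gt0// exprn_gt0. Qed.

Lemma sqr_gauss_max_level n : (0 < n)%N ->
  gauss_max_level sigma n ^+ 2 = 2 * sigma ^+ 2 * ln n%:R.
Proof. by move=> n0; rewrite sqr_sqrtr// mulr_ge0 ?(ltW var2_gt0)// ln_ge0// ler1n. Qed.

Lemma expR_gauss_max_level n : (0 < n)%N ->
  n%:R * expR (- gauss_max_level sigma n ^+ 2 / (2 * sigma ^+ 2)) = 1.
Proof.
move=> n0; rewrite sqr_gauss_max_level// mulNr mulrAC divff ?gt_eqF// mul1r.
by rewrite expRN lnK ?posrE ?ltr0n// divff// pnatr_eq0 -lt0n.
Qed.

(** [(b + s / (2 * b)) ^+ 2 >= b ^+ 2 + s], and [b ^+ 2] cancels the factor [n]. *)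
Lemma union_bound_at_level n s : (0 < n)%N -> 0 < gauss_max_level sigma n ->
  n%:R * expR (- (gauss_max_level sigma n + s / (2 * gauss_max_level sigma n)) ^+ 2 /
               (2 * sigma ^+ 2)) <= expR (- s / (2 * sigma ^+ 2)).
Proof.
move=> n0; have := expR_gauss_max_level n0; set b := gauss_max_level _ _.
move=> nb b0; rewrite -[leRHS]mul1r -[X in _ <= X * _]nb -mulrA ler_pM2l ?ltr0n// -expRD ler_expR.
rewrite -mulrDl ler_pM2r ?invr_gt0// sqrrD.
have -> : b * (s / (2 * b)) *+ 2 = s by field; rewrite gt_eqF.
have := sqr_ge0 (s / (2 * b)); lra.
Qed.

(** With [z = s / b] and [e = r / b], the hypothesis [s <= b ^+ 2] says [z <= b],
    so that the square of [b - z] is at most [b ^+ 2 - b * z = b ^+ 2 - s]; the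
    two shifts by [e] cost a bounded amount since [e * b = r]. *)
Lemma lower_level_sqr_le (r b s : R) : 0 <= r -> 1 <= b -> 0 <= s <= b ^+ 2 ->
  ((b - s / b) + r / b + r / b) ^+ 2 <= b ^+ 2 - s + (4 * r + 4 * r ^+ 2).
Proof.
move=> r0 b1 /andP[s0 sb2]; have b0 : 0 < b by lra.
pose z := s / b; pose e := r / b.
have sE : s = z * b by rewrite /z divfK// gt_eqF.
have rE : r = e * b by rewrite /e divfK// gt_eqF.
have z0 : 0 <= z by rewrite divr_ge0// ltW.
have e0 : 0 <= e by rewrite divr_ge0// ltW.
have zb : z <= b by rewrite ler_pdivrMr// -expr2.
have er : e <= r by rewrite ler_pdivrMr// ler_peMr.
have : e ^+ 2 <= r ^+ 2 by rewrite lerXn2r ?nnegrE.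
have : z * z <= z * b by rewrite ler_wpM2l.
have : 0 <= e * z by rewrite mulr_ge0.
rewrite -/z -/e sE => h1 h2 h3.
move: rE h1 h2 h3; clearbody z e; nra.
Qed.

Lemma powR_gauss_max_level n p : 1 <= ln (n%:R : R) ->
  gauss_max_level sigma n `^ p =
  (2 * sigma ^+ 2) `^ (p / 2) * expR (p / 2 * ln (ln n%:R)).
Proof.
move=> l1; have l0 : 0 < ln (n%:R : R) by lra.
rewrite /gauss_max_level -powR12_sqrt; last by rewrite mulr_ge0// ltW.
rewrite -powRrM [_^-1 * p]mulrC powRM ?ltW//; congr (_ * _).
by rewrite /powR gt_eqF.
Qed.

(** The factor left in the lower bound for the expected number of copies above
    [theta + b - s / b] once the powers of [ln n] have cancelled. *)
Definition exceedance_const (alpha r L : R) :=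
  L^-1 * r `^ (alpha + 1) * normal_peak sigma *
  expR (- (4 * r + 4 * r ^+ 2) / (2 * sigma ^+ 2)) /
  (2 * sigma ^+ 2) `^ ((alpha + 1) / 2).

Lemma exceedance_const_gt0 (alpha r L : R) : 0 < r -> 0 < L -> 0 < exceedance_const alpha r L.
Proof.
move=> r0 L0; rewrite /exceedance_const divr_gt0 ?powR_gt0//.
by rewrite !mulr_gt0 ?normal_peak_gt0 ?gt_eqF ?expR_gt0 ?powR_gt0 ?invr_gt0.
Qed.

(** The right-hand side is [n] times the lower bound of [gauss_sum_tail_ge] at
    [delta = r / b]. The factor [b `^ (- (alpha + 1))] that it contains is of order
    [expR (- (alpha + 1) / 2 * ln (ln n))], and the coefficient
    [sigma ^+ 2 * (alpha + 1)] in [s] compensates for it. *)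
Lemma expected_exceedances_ge (alpha r L t : R) (n : nat) :
  let b := gauss_max_level sigma n in
  let s := t + sigma ^+ 2 * (alpha + 1) * ln (ln n%:R) in
  0 <= alpha -> 0 < r -> 0 < L -> (0 < n)%N -> 1 <= b -> 1 <= ln (n%:R : R) ->
  0 <= s <= b ^+ 2 ->
  exceedance_const alpha r L * expR (t / (2 * sigma ^+ 2)) <=
  n%:R * (L^-1 * (r / b) `^ alpha *
    ((r / b) * normal_pdf 0 sigma ((b - s / b) + r / b + r / b))).
Proof.
move=> b s alpha0 r0 L0 n0 b1 l1 sb.
have b0 : 0 < b by lra.
have a1 : alpha + 1 != 0 by rewrite gt_eqF//; lra.
rewrite normal_pdfE ?gt_eqF// /normal_fun subr0.
rewrite -[sigma ^+ 2 *+ 2]mulr_natl.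
have rb : 0 <= r / b by rewrite divr_ge0// ltW.
set w := (_ + r / b + r / b).
have -> : n%:R * (L^-1 * (r / b) `^ alpha * (r / b *
    (normal_peak sigma * expR (- w ^+ 2 / (2 * sigma ^+ 2))))) =
  L^-1 * (r / b) `^ (alpha + 1) * normal_peak sigma *
   (n%:R * expR (- w ^+ 2 / (2 * sigma ^+ 2))).
  by rewrite powRD ?(negbTE a1)// powRr1//; ring.
have E : expR (- (4 * r + 4 * r ^+ 2) / (2 * sigma ^+ 2)) *
    expR (s / (2 * sigma ^+ 2)) <= n%:R * expR (- w ^+ 2 / (2 * sigma ^+ 2)).
  rewrite -[leLHS]mul1r -[X in X * _ <= _](expR_gauss_max_level n0) -mulrA ler_pM2l ?ltr0n//.
  rewrite -!expRD ler_expR -!mulrDl ler_pM2r ?invr_gt0//.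
  have := lower_level_sqr_le (ltW r0) b1 sb; rewrite -/w -/b; lra.
have Es : expR (s / (2 * sigma ^+ 2)) = expR (t / (2 * sigma ^+ 2)) *
    expR ((alpha + 1) / 2 * ln (ln n%:R)).
  rewrite -expRD; congr expR; rewrite /s; field.
  by rewrite gt_eqF.
apply: le_trans (ler_wpM2l _ E); last first.
  by rewrite !mulr_ge0 ?invr_ge0 ?powR_ge0 ?normal_peak_ge0// ltW.
rewrite powRM ?invr_ge0 ?(ltW r0) ?(ltW b0)// -[b^-1]powR_inv1 ?(ltW b0)// -powRrM mulN1r powRN.
rewrite (powR_gauss_max_level _ l1) Es /exceedance_const le_eqVlt; apply/orP; left.
have c1 : (2 * sigma ^+ 2) `^ ((alpha + 1) / 2) != 0 by rewrite gt_eqF// powR_gt0.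
have c2 : expR ((alpha + 1) / 2 * ln (ln (n%:R : R))) != 0 by rewrite gt_eqF// expR_gt0.
apply/eqP; field; rewrite c1 c2 gt_eqF//.
Qed.

End numeric.

Lemma exists_ln_ge (R : realType) (x : R) :
  exists n0 : nat, (1 <= n0)%N /\ forall n, (n0 <= n)%N -> x <= ln (n%:R : R).
Proof.
exists (Num.bound (expR x)).+1; split=> // n n0n.
have xn : expR x <= n%:R.
  by apply/ltW/(lt_le_trans (archi_boundP (expR_ge0 _))); rewrite ler_nat ltnW.
by rewrite -[leLHS]expRK ler_ln ?posrE ?expR_gt0// (lt_le_trans _ xn) ?expR_gt0.
Qed.

(** Turns the double exponential bound on the lower deviation into the single
    exponential of the theorem, through [x <= expR x]. *)
Lemma expRN_expR_le (R : realType) (K x : R) : 0 < K ->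
  expR (- (K * expR x)) <= K^-1 * expR (- x).
Proof.
move=> K0; rewrite !expRN -invfM lef_pV2 ?posrE ?expR_gt0 ?mulr_gt0 ?expR_gt0//.
by apply: le_trans (expR_ge1Dx _); lra.
Qed.

(** * Tail of the noisy variable above the endpoint *)

Section deviations.
Context (d : measure_display) (T : measurableType d) (R : realType).
Context (P : probability T R) (X eps Y : {RV P >-> R}).
Context (theta alpha beta r L sigma : R).
Hypotheses (L0 : 0 < L) (sigma0 : 0 < sigma).
Hypotheses (epsN : has_law eps (normal_prob 0 sigma)).
Hypotheses (YE : forall w, Y w = X w + eps w).

(** [theta + u] splits as [theta - delta] for [X] plus [u + delta] for the noise;
    one more [delta] is the width of the interval on which the Gaussian mass is
    collected. *)
Lemma gauss_sum_tail_ge (delta u : R) :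
  independent_RV2 X eps -> endpoint_tail_bounds X theta alpha beta r L ->
  0 < delta <= r -> 0 <= u ->
  ((L^-1 * delta `^ alpha * (delta * normal_pdf 0 sigma (u + delta + delta)))%:E
    <= P (Y @^-1` `[(theta + u)%R, +oo[))%E.
Proof.
move=> ind tail /[dup] dr /andP[delta0 _] u0.
have := sum_tail_ge (theta - delta) (u + delta) ind YE.
rewrite (_ : theta - delta + (u + delta) = theta + u); last by ring.
apply: le_trans; rewrite EFinM; apply: lee_pmul.
- by rewrite lee_fin mulr_ge0 ?powR_ge0// invr_ge0 ltW.
- by rewrite lee_fin mulr_ge0 ?normal_pdf_ge0// ltW.
- by have /andP[+ _] := tail delta dr; rewrite -ccdf_1_cdf.
- rewrite [leRHS](epsN (measurable_itv `[u + delta, +oo[)).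
  by apply: normal_prob_tail_ge; rewrite ?gt_eqF//; lra.
Qed.

(** The slack [eta] spares a passage to the limit: the endpoint is a supremum, so
    [X > theta + eta] is visibly null for each [eta > 0]. *)
Lemma gauss_sum_tail_le (eta v : R) :
  right_endpoint X = theta%:E -> 0 < eta -> 0 <= v ->
  (P (Y @^-1` `](theta + eta + v)%R, +oo[) <=
   (expR (- v ^+ 2 / (2 * sigma ^+ 2)))%:E)%E.
Proof.
move=> Xtheta eta0 v0.
apply: (le_trans (sum_tail_le v YE (prob_gt_right_endpoint Xtheta _))).
  lra.
rewrite [leLHS](epsN (measurable_itv `]v, +oo[)).
apply: normal_prob_tail_le; rewrite ?gt_eqF// => x/=.
by rewrite in_itv/= andbT => /ltW.
Qed.

End deviations.

(** * The deviation inequality *)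

Theorem theorem1 (R : realType) (alpha beta r L sigma : R)
    (hbeta : 0 <= beta) (halpha : beta <= alpha) (hr : 0 < r) (hL : 0 < L)
    (hsigma : 0 < sigma) :
  exists (n0 : nat) (c0 c1 c2 : R),
    [/\ (1 <= n0)%N, 0 < c0, 0 < c1, 0 < c2 &
    forall (d : measure_display) (T : measurableType d) (P : probability T R)
      (X eps Y : {RV P >-> R}) (Ys : nat -> {RV P >-> R}) (theta : R),
      has_law eps (normal_prob 0 sigma) ->
      independent_RV2 X eps ->
      (forall w, Y w = X w + eps w) ->
      mutually_independent Ys ->
      (forall i, has_law (Ys i) (distribution P Y)) ->
      right_endpoint X = theta%:E ->
      endpoint_tail_bounds X theta alpha beta r L ->
      forall (n : nat) (t : R), (n0 <= n)%N -> 0 < t ->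
        (P [set w | (t + c0 * ln (ln n%:R)) / gauss_max_level sigma n <
             `|running_max Ys n w - gauss_max_level sigma n - theta|]%R <=
         (c1 * expR (- t / (2 * sigma ^+ 2)) + expR (- c2 * n%:R))%:E)%E].
Proof.
have v0 : 0 < 2 * sigma ^+ 2 by rewrite mulr_gt0// exprn_gt0.
(* Large n makes both ln (ln n) >= 0 and gauss_max_level sigma n >= 1. *)
have [n0 [n01 n0P]] := exists_ln_ge (1 + (2 * sigma ^+ 2)^-1).
pose K := exceedance_const sigma alpha r L.
have K0 : 0 < K by exact: exceedance_const_gt0.
(* The lower bound on P (Y >= theta) given by gauss_sum_tail_ge at
   delta = r and u = 0. *)
pose c2 := L^-1 * r `^ alpha * (r * normal_pdf 0 sigma (0 + r + r)).
exists n0, (sigma ^+ 2 * (alpha + 1)), (1 + K^-1), c2; split => //.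
- by rewrite mulr_gt0 ?exprn_gt0//; lra.
- by rewrite addr_gt0// invr_gt0.
- rewrite /c2 !mulr_gt0 ?invr_gt0 ?powR_gt0// normal_pdfE ?gt_eqF//.
  by rewrite mulr_gt0 ?expR_gt0 ?normal_peak_gt0 ?gt_eqF.
move=> d T P X eps Y Ys theta epsN ind YE indY YsY Xtheta tail n t n0n t0.
have npos : (0 < n)%N by exact: leq_trans n0n.
have lnn := n0P n n0n.
have iv0 : 0 < (2 * sigma ^+ 2)^-1 by rewrite invr_gt0.
have l1 : 1 <= ln (n%:R : R) by lra.
set b := gauss_max_level sigma n; set s := t + _.
have b1 : 1 <= b.
  rewrite -(@ler_pXn2r _ 2) ?nnegrE ?sqrtr_ge0// sqr_gauss_max_level// expr1n.
  by rewrite mulrC -ler_pdivrMr//; lra.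
have b0 : 0 < b by lra.
have s0 : t <= s.
  rewrite lerDl mulr_ge0 ?ln_ge0// mulr_ge0 ?sqr_ge0//; lra.
have -> : [set w | s / b < `|running_max Ys n w - b - theta|] =
    [set w | theta + b + s / b < running_max Ys n w] `|`
    [set w | running_max Ys n w < theta + (b - s / b)].
  apply/seteqP; split=> w /=; rewrite ltr_normr.
    by case/orP=> ?; [left|right]; lra.
  by case=> ?; apply/orP; [left|right]; lra.
apply: (le_trans (measureU2 _ (measurable_running_max_gt _ _ _)
  (measurable_running_max_lt _ _ _))) => //.
have -> : (1 + K^-1) * expR (- t / (2 * sigma ^+ 2)) + expR (- c2 * n%:R) =
   expR (- t / (2 * sigma ^+ 2)) +
   (K^-1 * expR (- t / (2 * sigma ^+ 2)) + expR (- c2 * n%:R)) by ring.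
rewrite EFinD; apply: leeD.
  apply: (le_trans (prob_running_max_gt_le YsY _ npos)).
  (* Half of s / b is the slack above theta, half is left to the noise. *)
  have -> : theta + b + s / b = theta + s / (2 * b) + (b + s / (2 * b)).
    by field; rewrite gt_eqF.
  have sb : 0 < s / (2 * b) by rewrite divr_gt0 ?mulr_gt0//; lra.
  apply: (@le_trans _ _ (n%:R%:E *
      (expR (- (b + s / (2 * b)) ^+ 2 / (2 * sigma ^+ 2)))%:E)%E).
    by rewrite lee_pmul2l ?lte_fin ?ltr0n// (gauss_sum_tail_le hsigma epsN YE Xtheta)//; lra.
  rewrite -EFinM lee_fin; apply: (le_trans (union_bound_at_level _ _ _ _)) => //.
  by rewrite ler_expR ler_pM2r// lerN2.
have [sb|sb] := leP s (b ^+ 2).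
  have u0 : 0 <= b - s / b by rewrite subr_ge0 ler_pdivrMr// -expr2.
  have db : 0 < r / b <= r by rewrite divr_gt0//= ler_pdivrMr// ler_peMr// ltW.
  have := gauss_sum_tail_ge hL hsigma epsN YE ind tail db u0.
  move/(prob_running_max_lt_le YsY indY npos) => /le_trans; apply.
  rewrite lee_fin -[leLHS]addr0 lerD ?expR_ge0//.
  rewrite mulNr; apply: le_trans (expRN_expR_le _ K0).
  rewrite ler_expR lerN2; apply: expected_exceedances_ge => //; first lra.
  by rewrite sb andbT -/s; lra.
(* Here b - s / b < 0, so the lower deviation makes every copy less than
   theta. *)
have rr : 0 < r <= r by rewrite hr lexx.
have u0 : theta + (b - s / b) <= theta + 0.
  by rewrite lerD2l subr_le0 ler_pdivlMr// -expr2 ltW.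
have := gauss_sum_tail_ge hL hsigma epsN YE ind tail rr (lexx 0).
rewrite -/c2 => /(prob_running_max_lt_le YsY indY npos) h.
apply: (@le_trans _ _ (P [set w | running_max Ys n w < theta + 0])).
  apply: prob_sub; [exact: measurable_running_max_lt..|].
  by move=> w /= /lt_le_trans; apply.
apply: (le_trans h); rewrite lee_fin -[leLHS]add0r lerD//.
  by rewrite mulr_ge0 ?expR_ge0// invr_ge0 ltW.
by rewrite mulrC mulNr.
Qed.
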